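(* Let $\mathscr{C}$ be an almost finitary $J$-artinian bicategory and $\mathbf{M}$ a transitive almost finitary birepresentation of $\mathscr{C}$. Denote by $\mathscr{C}_{\mathbf{M}}$ the quotient of $\mathscr{C}$ by the biideal of all $2$-morphisms annihilated by $\mathbf{M}$. Then $\mathscr{C}_{\mathbf{M}}$ has a unique maximal two-sided cell, where maximal is meant with respect to the partial order on two-sided cells induced by $\leq_J$.
   Context: $\Bbbk$ is an algebraically closed field. A category is almost finitary if it is an essentially small additive $\Bbbk$-linear Krull--Schmidt category with at most countably many isomorphism classes of indecomposable objects and finite-dimensional morphism spaces; $\mathfrak{A}^{af}_\Bbbk$ is the $2$-category of almost finitary categories, $\Bbbk$-linear functors and natural transformations. A bicategory $\mathscr{C}$ is almost finitary if it has countably many objects, every $\mathscr{C}(\mathtt{i},\mathtt{j})$ is almost finitary, horizontal composition (written as juxtaposition) is biadditive and $\Bbbk$-linear, and each identity $1$-morphism $\mathbb{1}_{\mathtt{i}}$ is indecomposable. An almost finitary birepresentation is a pseudofunctor $\mathbf{M}\colon\mathscr{C}\to\mathfrak{A}^{af}_\Bbbk$; write $FX=\mathbf{M}(F)X$. It is transitive if (it is nonzero and) for every nonzero object $X$ of any $\mathbf{M}(\mathtt{i})$ and every $\mathtt{j}$, the category $\mathbf{M}(\mathtt{j})$ equals the additive closure (direct summands of finite direct sums) of $\{FX\mid F\in\mathscr{C}(\mathtt{i},\mathtt{j})\}$. For indecomposable $1$-morphisms $F,G$, write $F\geq_J G$ if $F$ is isomorphic to a direct summand of $HGH'$ for some $1$-morphisms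 $H,H'$. Equivalence classes of the associated equivalence relation are the two-sided cells, and $\leq_J$ induces a partial order on them. $\mathscr{C}$ is $J$-artinian if every ascending chain of two-sided cells stabilizes. *)

(* Defs.v *)
From HB Require Import structures.
From mathcomp Require Import all_boot all_order all_algebra.
From mathcomp Require Import boolp classical_sets.

Set Implicit Arguments.
Unset Strict Implicit.
Unset Printing Implicit Defensive.

Import GRing.Theory.
Local Open Scope ring_scope.

Declare Scope bicat_scope.
Delimit Scope bicat_scope with bicat.
Local Open Scope bicat_scope.

Record linCat (k : fieldType) := LinCat {
  ob :> Type;
  hom : ob -> ob -> lmodType k;
  idm : forall X, hom X X;
  ccomp : forall X Y Z, hom Y Z -> hom X Y -> hom X Z;
  comp1m : forall X Y (f : hom X Y), ccomp (idm Y) f = f;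
  compm1 : forall X Y (f : hom X Y), ccomp f (idm X) = f;
  compA : forall X Y Z W (h : hom Z W) (g : hom Y Z) (f : hom X Y),
    ccomp h (ccomp g f) = ccomp (ccomp h g) f;
  comp_linearl : forall X Y Z (f : hom X Y),
    linear (fun g : hom Y Z => ccomp g f);
  comp_linearr : forall X Y Z (g : hom Y Z),
    linear (fun f : hom X Y => ccomp g f) }.

Arguments hom {k l} X Y.
Arguments idm {k l} X.
Arguments ccomp {k l X Y Z} g f.
Notation "g \oc f" := (ccomp g f)
  (at level 45, left associativity) : bicat_scope.

Record iso (k : fieldType) (A : linCat k) (X Y : A) := Iso {
  fwd :> hom X Y;
  bwd : hom Y X;
  bwdK : bwd \oc fwd = idm X;
  fwdK : fwd \oc bwd = idm Y }.

Section LinCatNotions.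
Variables (k : fieldType) (A : linCat k).
Implicit Types X Y Z : A.

Definition is_zero X := forall Y,
  (forall f : hom X Y, f = 0) /\ (forall f : hom Y X, f = 0).

Definition is_biproduct X Y Z :=
  exists (iY : hom Y X) (iZ : hom Z X) (pY : hom X Y) (pZ : hom X Z),
    [/\ pY \oc iY = idm Y, pZ \oc iZ = idm Z, pY \oc iZ = 0, pZ \oc iY = 0
      & iY \oc pY + iZ \oc pZ = idm X].

Definition is_direct_sum X (n : nat) (Xs : 'I_n -> A) :=
  exists (i : forall a, hom (Xs a) X) (p : forall a, hom X (Xs a)),
    [/\ forall a, p a \oc i a = idm (Xs a),
        forall a b, a != b -> p a \oc i b = 0
      & \sum_a (i a \oc p a) = idm X].

Definition direct_summand Y X := exists Z, is_biproduct X Y Z.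

Definition indecomposable X :=
  ~ is_zero X /\
  forall Y Z, is_biproduct X Y Z -> is_zero Y \/ is_zero Z.

Definition additive_cat :=
  (exists X, is_zero X) /\ (forall Y Z, exists X, is_biproduct X Y Z).

Definition invertible X Y (f : hom X Y) :=
  exists g : hom Y X, g \oc f = idm X /\ f \oc g = idm Y.

Definition local_end X :=
  idm X <> 0 /\
  forall f g : hom X X, invertible (f + g) -> invertible f \/ invertible g.

Definition krull_schmidt := forall X, exists (n : nat) (Xs : 'I_n -> A),
  (forall a, local_end (Xs a)) /\ is_direct_sum X Xs.

Definition finite_dim (V : lmodType k) := exists (n : nat) (b : 'I_n -> V),
  forall v, exists c : 'I_n -> k, v = \sum_a c a *: b a.

Definition countably_many_indecomposables := exists Xs : nat -> A,
  forall X, indecomposable X -> exists n, inhabited (iso X (Xs n)).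

(* Essential smallness needs no clause of its own: a Krull-Schmidt category
   with countably many isomorphism classes of indecomposables has countably
   many isomorphism classes of objects. *)
Definition almost_finitary_cat :=
  [/\ additive_cat, krull_schmidt, countably_many_indecomposables
    & forall X Y, finite_dim (hom X Y)].

Definition add_closure (S : set A) : set A := [set Y | exists X n
  (Xs : 'I_n -> A),
  [/\ forall a, S (Xs a), is_direct_sum X Xs & direct_summand Y X]].

End LinCatNotions.

Record afCat (k : fieldType) := AfCat {
  af_cat :> linCat k;
  af_catP : almost_finitary_cat af_cat }.

Record linFun (k : fieldType) (A B : linCat k) := LinFun {
  fob :> A -> B;
  fmap : forall X Y, {linear hom X Y -> hom (fob X) (fob Y)};
  fmap1 : forall X, fmap X X (idm X) = idm (fob X);
  fmapM : forall X Y Z (g : hom Y Z) (f : hom X Y),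
    fmap X Z (g \oc f) = fmap Y Z g \oc fmap X Y f }.

Arguments fmap {k A B} F {X Y} : rename.

Record natTrans (k : fieldType) (A B : linCat k) (F G : linFun A B) :=
NatTrans {
  nt :> forall X, hom (F X) (G X);
  ntP : forall X Y (f : hom X Y), fmap G f \oc nt X = nt Y \oc fmap F f }.

(* Hom categories are linear and horizontal composition is bilinear on
   2-morphisms.  For F : i -> j and G : j -> l, the composite i -> l is
   G \o1 F.  *)

Record bicat (k : fieldType) := Bicat {
  ob0 :> Type;
  mor1 : ob0 -> ob0 -> linCat k;
  id1 : forall i, mor1 i i;
  hcomp : forall i j l, mor1 j l -> mor1 i j -> mor1 i l;
  hcomp2 : forall i j l (G G' : mor1 j l) (F F' : mor1 i j),
    hom G G' -> hom F F' -> hom (hcomp G F) (hcomp G' F');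
  hcomp2_id : forall i j l (G : mor1 j l) (F : mor1 i j),
    hcomp2 (idm G) (idm F) = idm (hcomp G F);
  hcomp2_comp : forall i j l (G G' G'' : mor1 j l) (F F' F'' : mor1 i j)
    (b' : hom G' G'') (b : hom G G') (a' : hom F' F'') (a : hom F F'),
    hcomp2 (b' \oc b) (a' \oc a) = hcomp2 b' a' \oc hcomp2 b a;
  hcomp2_linearl : forall i j l (G G' : mor1 j l) (F F' : mor1 i j)
    (a : hom F F'), linear (fun b : hom G G' => hcomp2 b a);
  hcomp2_linearr : forall i j l (G G' : mor1 j l) (F F' : mor1 i j)
    (b : hom G G'), linear (fun a : hom F F' => hcomp2 b a);
  assoc : forall i j l m (H : mor1 l m) (G : mor1 j l) (F : mor1 i j),
    iso (hcomp (hcomp H G) F) (hcomp H (hcomp G F));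
  lunit : forall i j (F : mor1 i j), iso (hcomp (id1 j) F) F;
  runit : forall i j (F : mor1 i j), iso (hcomp F (id1 i)) F;
  assoc_nat : forall i j l m (H H' : mor1 l m) (G G' : mor1 j l)
    (F F' : mor1 i j) (c : hom H H') (b : hom G G') (a : hom F F'),
    assoc H' G' F' \oc hcomp2 (hcomp2 c b) a
    = hcomp2 c (hcomp2 b a) \oc assoc H G F;
  lunit_nat : forall i j (F F' : mor1 i j) (a : hom F F'),
    lunit F' \oc hcomp2 (idm (id1 j)) a = a \oc lunit F;
  runit_nat : forall i j (F F' : mor1 i j) (a : hom F F'),
    runit F' \oc hcomp2 a (idm (id1 i)) = a \oc runit F;
  pentagon : forall i j l m n (K : mor1 m n) (H : mor1 l m) (G : mor1 j l)
    (F : mor1 i j),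
    hcomp2 (idm K) (assoc H G F) \oc assoc K (hcomp H G) F
      \oc hcomp2 (assoc K H G) (idm F)
    = assoc K H (hcomp G F) \oc assoc (hcomp K H) G F;
  triangle : forall i j l (G : mor1 j l) (F : mor1 i j),
    hcomp2 (idm G) (lunit F) \oc assoc G (id1 j) F
    = hcomp2 (runit G) (idm F) }.

Arguments mor1 {k C} i j : rename.
Arguments id1 {k C} i : rename.
Arguments hcomp {k C i j l} G F : rename.
Arguments hcomp2 {k C i j l G G' F F'} b a : rename.
Arguments assoc {k C i j l m} H G F : rename.
Arguments lunit {k C i j} F : rename.
Arguments runit {k C i j} F : rename.
Notation "G \o1 F" := (hcomp G F)
  (at level 40, left associativity) : bicat_scope.
Notation "b \o2 a" := (hcomp2 b a)
  (at level 40, left associativity) : bicat_scope.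

Definition almost_finitary_bicat (k : fieldType) (C : bicat k) :=
  [/\ exists f : C -> nat, injective f,
      forall i j : C, almost_finitary_cat (mor1 i j)
    & forall i : C, indecomposable (id1 i)].

(* fmap of a linFun is linear, so pseudofunctors are linear on 2-morphisms;
   this is what makes the annihilator below a biideal. *)

Record pseudofunctor (k : fieldType) (C D : bicat k) := Pseudofunctor {
  pf0 :> C -> D;
  pf1 : forall i j, linFun (mor1 i j : linCat k) (mor1 (pf0 i) (pf0 j));
  pf_comp : forall i j l (G : mor1 j l) (F : mor1 i j),
    iso (pf1 j l G \o1 pf1 i j F) (pf1 i l (G \o1 F));
  pf_id : forall i, iso (id1 (pf0 i)) (pf1 i i (id1 i));
  pf_comp_nat : forall i j l (G G' : mor1 j l) (F F' : mor1 i j)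
    (b : hom G G') (a : hom F F'),
    pf_comp G' F' \oc (fmap (pf1 j l) b \o2 fmap (pf1 i j) a)
    = fmap (pf1 i l) (b \o2 a) \oc pf_comp G F;
  pf_assoc : forall i j l m (H : mor1 l m) (G : mor1 j l) (F : mor1 i j),
    fmap (pf1 i m) (fwd (assoc H G F)) \oc pf_comp (H \o1 G) F
      \oc (pf_comp H G \o2 idm (pf1 i j F))
    = pf_comp H (G \o1 F) \oc (idm (pf1 l m H) \o2 pf_comp G F)
      \oc assoc (pf1 l m H) (pf1 j l G) (pf1 i j F);
  pf_lunit : forall i j (F : mor1 i j),
    fmap (pf1 i j) (fwd (lunit F)) \oc pf_comp (id1 j) F
      \oc (pf_id j \o2 idm (pf1 i j F))
    = lunit (pf1 i j F);
  pf_runit : forall i j (F : mor1 i j),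
    fmap (pf1 i j) (fwd (runit F)) \oc pf_comp F (id1 i)
      \oc (idm (pf1 i j F) \o2 pf_id i)
    = runit (pf1 i j F) }.

Arguments pf1 {k C D} M {i j} : rename.

Section LinearLemmas.
Variable k : fieldType.

Lemma linear_B (U V : lmodType k) (f : U -> V) (lf : linear f) x y :
  f (x - y) = f x - f y.
Proof. by rewrite addrC -scaleN1r lf scaleN1r addrC. Qed.

Lemma linear_D (U V : lmodType k) (f : U -> V) (lf : linear f) x y :
  f (x + y) = f x + f y.
Proof. by rewrite -[x in LHS]scale1r lf scale1r. Qed.

Lemma linear_0 (U V : lmodType k) (f : U -> V) (lf : linear f) : f 0 = 0.
Proof. by rewrite -[X in f X](subrr 0) (linear_B lf) subrr. Qed.

Lemma linear_Z (U V : lmodType k) (f : U -> V) (lf : linear f) c x :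
  f (c *: x) = c *: f x.
Proof. by rewrite -[X in f X]addr0 lf (linear_0 lf) addr0. Qed.

Variable A : linCat k.
Implicit Types X Y Z : A.

Lemma compDl X Y Z (g g' : hom Y Z) (f : hom X Y) :
  (g + g') \oc f = g \oc f + g' \oc f.
Proof. exact: (linear_D (comp_linearl f)). Qed.

Lemma compDr X Y Z (g : hom Y Z) (f f' : hom X Y) :
  g \oc (f + f') = g \oc f + g \oc f'.
Proof. exact: (linear_D (comp_linearr g)). Qed.

Lemma compBl X Y Z (g g' : hom Y Z) (f : hom X Y) :
  (g - g') \oc f = g \oc f - g' \oc f.
Proof. exact: (linear_B (comp_linearl f)). Qed.

Lemma compBr X Y Z (g : hom Y Z) (f f' : hom X Y) :
  g \oc (f - f') = g \oc f - g \oc f'.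
Proof. exact: (linear_B (comp_linearr g)). Qed.

Lemma comp0l X Y Z (f : hom X Y) : (0 : hom Y Z) \oc f = 0.
Proof. exact: (linear_0 (comp_linearl f)). Qed.

Lemma comp0r X Y Z (g : hom Y Z) : g \oc (0 : hom X Y) = 0.
Proof. exact: (linear_0 (comp_linearr g)). Qed.

Lemma compNl X Y Z (g : hom Y Z) (f : hom X Y) : (- g) \oc f = - (g \oc f).
Proof. by rewrite -sub0r compBl comp0l sub0r. Qed.

Lemma compNr X Y Z (g : hom Y Z) (f : hom X Y) : g \oc (- f) = - (g \oc f).
Proof. by rewrite -sub0r compBr comp0r sub0r. Qed.

Lemma compZl X Y Z c (g : hom Y Z) (f : hom X Y) :
  (c *: g) \oc f = c *: (g \oc f).
Proof. exact: (linear_Z (comp_linearl f)). Qed.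

Lemma compZr X Y Z c (g : hom Y Z) (f : hom X Y) :
  g \oc (c *: f) = c *: (g \oc f).
Proof. exact: (linear_Z (comp_linearr g)). Qed.

Definition id_iso X : iso X X := Iso (comp1m (idm X)) (comp1m (idm X)).

End LinearLemmas.

Section NatTransModule.
Variables (k : fieldType) (A B : linCat k) (F G : linFun A B).

Lemma natTrans_eq (s t : natTrans F G) : (forall X, s X = t X) -> s = t.
Proof.
case: s t => [s sP] [t tP] /= st.
have {}st : s = t by apply: functional_extensionality_dep.
by case: _ / st tP => tP; congr NatTrans; exact: Prop_irrelevance.
Qed.

Lemma nt_zeroP X Y (f : hom X Y) :
  fmap G f \oc (0 : hom (F X) (G X)) = 0 \oc fmap F f.
Proof. by rewrite comp0l comp0r. Qed.
Definition nt_zero : natTrans F G := NatTrans nt_zeroP.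

Lemma nt_oppP (s : natTrans F G) X Y (f : hom X Y) :
  fmap G f \oc (- s X) = (- s Y) \oc fmap F f.
Proof. by rewrite compNl compNr ntP. Qed.
Definition nt_opp s : natTrans F G := NatTrans (nt_oppP s).

Lemma nt_addP (s t : natTrans F G) X Y (f : hom X Y) :
  fmap G f \oc (s X + t X) = (s Y + t Y) \oc fmap F f.
Proof. by rewrite compDl compDr !ntP. Qed.
Definition nt_add s t : natTrans F G := NatTrans (nt_addP s t).

Lemma nt_scaleP c (s : natTrans F G) X Y (f : hom X Y) :
  fmap G f \oc (c *: s X) = (c *: s Y) \oc fmap F f.
Proof. by rewrite compZl compZr ntP. Qed.
Definition nt_scale c s : natTrans F G := NatTrans (nt_scaleP c s).

HB.instance Definition _ := gen_eqMixin (natTrans F G).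
HB.instance Definition _ := gen_choiceMixin (natTrans F G).

Lemma nt_addA : associative nt_add.
Proof. by move=> s t u; apply: natTrans_eq => X /=; rewrite addrA. Qed.
Lemma nt_addC : commutative nt_add.
Proof. by move=> s t; apply: natTrans_eq => X /=; rewrite addrC. Qed.
Lemma nt_add0 : left_id nt_zero nt_add.
Proof. by move=> s; apply: natTrans_eq => X /=; rewrite add0r. Qed.
Lemma nt_addN : left_inverse nt_zero nt_opp nt_add.
Proof. by move=> s; apply: natTrans_eq => X /=; rewrite addNr. Qed.

HB.instance Definition _ :=
  GRing.isZmodule.Build (natTrans F G) nt_addA nt_addC nt_add0 nt_addN.

Lemma nt_scaleA a b s : nt_scale a (nt_scale b s) = nt_scale (a * b) s.
Proof. by apply: natTrans_eq => X /=; rewrite scalerA. Qed.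
Lemma nt_scale1 : left_id 1 nt_scale.
Proof. by move=> s; apply: natTrans_eq => X /=; rewrite scale1r. Qed.
Lemma nt_scaleDr : right_distributive nt_scale +%R.
Proof. by move=> c s t; apply: natTrans_eq => X /=; rewrite scalerDr. Qed.
Lemma nt_scaleDl s : {morph nt_scale^~ s : a b / a + b}.
Proof. by move=> a b; apply: natTrans_eq => X /=; rewrite scalerDl. Qed.

HB.instance Definition _ := GRing.Zmodule_isLmodule.Build k (natTrans F G)
  nt_scaleA nt_scale1 nt_scaleDr nt_scaleDl.

End NatTransModule.

Section FunCat.
Variables (k : fieldType) (A B : linCat k).

Lemma nt_idP (F : linFun A B) X Y (f : hom X Y) :
  fmap F f \oc idm (F X) = idm (F Y) \oc fmap F f.
Proof. by rewrite comp1m compm1. Qed.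
Definition nt_id F : natTrans F F := NatTrans (@nt_idP F).

Lemma nt_compP (F G H : linFun A B) (t : natTrans G H) (s : natTrans F G)
  X Y (f : hom X Y) :
  fmap H f \oc (t X \oc s X) = (t Y \oc s Y) \oc fmap F f.
Proof. by rewrite compA ntP -compA ntP compA. Qed.
Definition nt_comp F G H (t : natTrans G H) (s : natTrans F G) :
  natTrans F H := NatTrans (nt_compP t s).

Program Definition funCat : linCat k :=
  @LinCat k (linFun A B) (fun F G => natTrans F G) nt_id nt_comp
    _ _ _ _ _.
Next Obligation. by apply: natTrans_eq => Z /=; rewrite comp1m. Qed.
Next Obligation. by apply: natTrans_eq => Z /=; rewrite compm1. Qed.
Next Obligation. by apply: natTrans_eq => V /=; rewrite compA. Qed.
Next Obligation.
by move=> c s t; apply: natTrans_eq => V /=; rewrite compDl compZl.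
Qed.
Next Obligation.
by move=> c s t; apply: natTrans_eq => V /=; rewrite compDr compZr.
Qed.

End FunCat.

Section AfBicat.
Variable k : fieldType.
Implicit Types A B D : linCat k.

Definition idFun A : linFun A A :=
  @LinFun k A A (fun X => X) (fun X Y => idfun) (fun _ => erefl)
    (fun _ _ _ _ _ => erefl).

Section CompFun.
Variables (A B D : linCat k) (G : linFun B D) (F : linFun A B).

Definition comp_fmap X Y : {linear hom X Y -> hom (G (F X)) (G (F Y))} :=
  @fmap k B D G (F X) (F Y) \o @fmap k A B F X Y.

Lemma comp_fmap1 X : comp_fmap X X (idm X) = idm (G (F X)).
Proof. by rewrite /= !fmap1. Qed.

Lemma comp_fmapM X Y Z (g : hom Y Z) (f : hom X Y) :
  comp_fmap X Z (g \oc f) = comp_fmap Y Z g \oc comp_fmap X Y f.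
Proof. by rewrite /= !fmapM. Qed.

Definition compFun : linFun A D := LinFun comp_fmap1 comp_fmapM.

End CompFun.

Lemma nt_hcompP A B D (G G' : linFun B D) (F F' : linFun A B)
  (b : natTrans G G') (a : natTrans F F') X Y (f : hom X Y) :
  fmap (compFun G' F') f \oc (b (F' X) \oc fmap G (a X))
  = (b (F' Y) \oc fmap G (a Y)) \oc fmap (compFun G F) f.
Proof. by rewrite /= compA ntP -!compA -!fmapM ntP. Qed.
Definition nt_hcomp A B D (G G' : linFun B D) (F F' : linFun A B)
  (b : natTrans G G') (a : natTrans F F') :
  natTrans (compFun G F) (compFun G' F') :=
  @NatTrans k A D (compFun G F) (compFun G' F')
    (fun X => b (F' X) \oc fmap G (a X)) (nt_hcompP b a).

Section NatIso.
Variables (A B : linCat k) (F G : linFun A B) (s : natTrans F G)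
  (t : forall X, hom (G X) (F X))
  (ts : forall X, t X \oc s X = idm (F X))
  (st : forall X, s X \oc t X = idm (G X)).

Lemma nt_invP X Y (f : hom X Y) : fmap F f \oc t X = t Y \oc fmap G f.
Proof.
by rewrite -[LHS]comp1m -ts -compA (compA (s Y)) -ntP -(compA _ (s X)) st
  compm1.
Qed.
Definition nt_inv : natTrans G F := NatTrans nt_invP.

Definition nt_iso : iso (F : funCat A B) G :=
  @Iso k (funCat A B) F G s nt_inv
    (natTrans_eq (s := nt_comp nt_inv s) (t := nt_id F) ts)
    (natTrans_eq (s := nt_comp s nt_inv) (t := nt_id G) st).

End NatIso.

(* The associators and unitors below have identity components. *)

Section AfAssoc.
Variables (A B D E : linCat k).
Variables (H : linFun D E) (G : linFun B D) (F : linFun A B).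
Let HGF1 : linFun A E := compFun (compFun H G) F.
Let HGF2 : linFun A E := compFun H (compFun G F).

Lemma af_assocP X Y (f : hom X Y) :
  fmap HGF2 f \oc idm (H (G (F X))) = idm (H (G (F Y))) \oc fmap HGF1 f.
Proof. by rewrite comp1m compm1. Qed.

Definition af_assoc : iso (HGF1 : funCat A E) HGF2 :=
  @nt_iso A E HGF1 HGF2
    (@NatTrans k A E HGF1 HGF2 (fun X => idm (H (G (F X)))) af_assocP)
    (fun X => idm (H (G (F X)))) (fun X => comp1m _) (fun X => comp1m _).

End AfAssoc.

Section AfUnit.
Variables (A B : linCat k) (F : linFun A B).

Lemma af_lunitP X Y (f : hom X Y) :
  fmap F f \oc idm (F X) = idm (F Y) \oc fmap (compFun (idFun B) F) f.
Proof. by rewrite comp1m compm1. Qed.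

Definition af_lunit : iso (compFun (idFun B) F : funCat A B) F :=
  @nt_iso A B (compFun (idFun B) F) F
    (@NatTrans k A B (compFun (idFun B) F) F (fun X => idm (F X)) af_lunitP)
    (fun X => idm (F X)) (fun X => comp1m _) (fun X => comp1m _).

Lemma af_runitP X Y (f : hom X Y) :
  fmap F f \oc idm (F X) = idm (F Y) \oc fmap (compFun F (idFun A)) f.
Proof. by rewrite comp1m compm1. Qed.

Definition af_runit : iso (compFun F (idFun A) : funCat A B) F :=
  @nt_iso A B (compFun F (idFun A)) F
    (@NatTrans k A B (compFun F (idFun A)) F (fun X => idm (F X)) af_runitP)
    (fun X => idm (F X)) (fun X => comp1m _) (fun X => comp1m _).

End AfUnit.

Definition afBicat : bicat k.
refine (@Bicat k (afCat k) (fun U V => funCat U V) (fun U => idFun U)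
  (fun U V W => @compFun U V W) (fun U V W => @nt_hcomp U V W)
  _ _ _ _
  (fun U V W T => @af_assoc U V W T)
  (fun U V => @af_lunit U V) (fun U V => @af_runit U V)
  _ _ _ _ _).
Proof.
- move=> A B D G F; apply: natTrans_eq => X /=; by rewrite fmap1 comp1m.
- move=> A B D G G' G'' F F' F'' b' b a' a; apply: natTrans_eq => X /=.
  by rewrite fmapM -!compA; congr (_ \oc _); rewrite !compA ntP.
- by move=> A B D G G' F F' a c b b'; apply: natTrans_eq => X /=;
    rewrite compDl compZl.
- by move=> A B D G G' F F' b c a a'; apply: natTrans_eq => X /=;
    rewrite linearP compDr compZr.
- move=> A B D E H H' G G' F F' c b a; apply: natTrans_eq => X /=.
  by rewrite comp1m compm1 fmapM compA.
- by move=> A B F F' a; apply: natTrans_eq => X /=; rewrite !comp1m compm1.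
- move=> A B F F' a; apply: natTrans_eq => X /=.
  by rewrite fmap1 !compm1 comp1m.
- move=> A B D E E' K H G F; apply: natTrans_eq => X /=.
  by rewrite !fmap1 !comp1m.
- by move=> A B D G F; apply: natTrans_eq => X /=; rewrite !fmap1 !comp1m.
Defined.

End AfBicat.

Record submodule (k : fieldType) (V : lmodType k) := Submodule {
  sub_pred :> pred V;
  sub_closed : submod_closed sub_pred }.

Definition sub_zmod (k : fieldType) (V : lmodType k) (I : submodule V) :
  zmodClosed V := HB.pack (sub_pred I)
    (GRing.isZmodClosed.Build V (sub_pred I)
      (GRing.submod_closedB (sub_closed I))).

Section QuotientModule.
Variables (k : fieldType) (V : lmodType k) (I : submodule V).
Local Open Scope quotient_scope.

Definition quot_mod := @Quotient.quot V (sub_zmod I).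
HB.instance Definition _ := GRing.Zmodule.on quot_mod.

Definition quot_pi (x : V) : quot_mod := \pi x.

Lemma quot_piP x y : quot_pi x = quot_pi y <-> x - y \in sub_pred I.
Proof.
by rewrite (@Quotient.idealrBE V (sub_zmod I)); split=> [xy|/eqP //];
  apply/eqP.
Qed.

Lemma quot_pi_surj (q : quot_mod) : exists x, quot_pi x = q.
Proof. by exists (repr q); rewrite /quot_pi reprK. Qed.

Lemma quot_piD x y : quot_pi (x + y) = quot_pi x + quot_pi y.
Proof. exact: (raddfD (\pi_quot_mod)). Qed.

Definition quot_scale (c : k) (q : quot_mod) : quot_mod :=
  quot_pi (c *: repr q).

Lemma quot_scale_pi c x : quot_scale c (quot_pi x) = quot_pi (c *: x).
Proof.
apply/quot_piP; rewrite -scalerBr.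
have [I0 IZ] := sub_closed I.
rewrite -[X in X \in _]addr0; apply: IZ => //.
by apply/quot_piP; rewrite /quot_pi reprK.
Qed.

Lemma quot_scaleA a b q :
  quot_scale a (quot_scale b q) = quot_scale (a * b) q.
Proof.
by have [x <-] := quot_pi_surj q; rewrite !quot_scale_pi scalerA.
Qed.
Lemma quot_scale1 : left_id 1 quot_scale.
Proof.
by move=> q; have [x <-] := quot_pi_surj q; rewrite quot_scale_pi scale1r.
Qed.
Lemma quot_scaleDr : right_distributive quot_scale +%R.
Proof.
move=> c q r; have [x <-] := quot_pi_surj q; have [y <-] := quot_pi_surj r.
by rewrite -quot_piD !quot_scale_pi scalerDr quot_piD.
Qed.
Lemma quot_scaleDl q : {morph quot_scale^~ q : a b / a + b}.
Proof.
move=> a b; have [x <-] := quot_pi_surj q.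
by rewrite !quot_scale_pi scalerDl quot_piD.
Qed.

HB.instance Definition _ := GRing.Zmodule_isLmodule.Build k quot_mod
  quot_scaleA quot_scale1 quot_scaleDr quot_scaleDl.

Lemma quot_pi_linear : linear (quot_pi : V -> (quot_mod : lmodType k)).
Proof. by move=> c x y; rewrite quot_piD -quot_scale_pi. Qed.

End QuotientModule.

Section Lift2.
Variables (k : fieldType) (U V W : lmodType k).
Variables (I : submodule U) (J : submodule V) (K : submodule W).
Variable f : U -> V -> W.
Hypotheses (linl : forall v, linear (f^~ v)) (linr : forall u, linear (f u)).
Hypotheses (fI : forall u v, u \in sub_pred I -> f u v \in sub_pred K).
Hypotheses (fJ : forall u v, v \in sub_pred J -> f u v \in sub_pred K).
Local Open Scope quotient_scope.

(* The bilinear map induced by f on quotients; see quot_lift2_pi. *)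
Definition quot_lift2 (p : quot_mod I) (q : quot_mod J) : quot_mod K :=
  quot_pi K (f (repr p) (repr q)).

Lemma quot_lift2_pi u v :
  quot_lift2 (quot_pi I u) (quot_pi J v) = quot_pi K (f u v).
Proof.
rewrite /quot_lift2.
have Eu : quot_pi I (repr (quot_pi I u)) = quot_pi I u.
  by rewrite /quot_pi reprK.
have Ev : quot_pi J (repr (quot_pi J v)) = quot_pi J v.
  by rewrite /quot_pi reprK.
set u' := repr _ in Eu *; set v' := repr _ in Ev *.
transitivity (quot_pi K (f u v')); apply/quot_piP.
  by rewrite -(linear_B (linl v')); apply: fI; apply/quot_piP.
by rewrite -(linear_B (linr u)); apply: fJ; apply/quot_piP.
Qed.

Lemma quot_lift2_linl q : linear (quot_lift2^~ q).
Proof.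
move=> c p p'; have [v <-] := quot_pi_surj q.
have [u <-] := quot_pi_surj p; have [u' <-] := quot_pi_surj p'.
by rewrite -quot_pi_linear !quot_lift2_pi linl quot_pi_linear.
Qed.

Lemma quot_lift2_linr p : linear (quot_lift2 p).
Proof.
move=> c q q'; have [u <-] := quot_pi_surj p.
have [v <-] := quot_pi_surj q; have [v' <-] := quot_pi_surj q'.
by rewrite -quot_pi_linear !quot_lift2_pi linr quot_pi_linear.
Qed.

End Lift2.

Record ideal (k : fieldType) (A : linCat k) := Ideal {
  id_sub :> forall X Y : A, submodule (hom X Y);
  id_compl : forall X Y Z (g : hom Y Z) (f : hom X Y),
    f \in sub_pred (id_sub X Y) -> g \oc f \in sub_pred (id_sub X Z);
  id_compr : forall X Y Z (g : hom Y Z) (f : hom X Y),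
    g \in sub_pred (id_sub Y Z) -> g \oc f \in sub_pred (id_sub X Z) }.

Section QuotCat.
Variables (k : fieldType) (A : linCat k) (I : ideal A).

Definition quot_comp (X Y Z : A) :
  quot_mod (I Y Z) -> quot_mod (I X Y) -> quot_mod (I X Z) :=
  quot_lift2 (I X Z) (fun g f => g \oc f).

Lemma quot_comp_pi (X Y Z : A) (g : hom Y Z) (f : hom X Y) :
  quot_comp (quot_pi (I Y Z) g) (quot_pi (I X Y) f)
  = quot_pi (I X Z) (g \oc f).
Proof.
apply: quot_lift2_pi => [v|u|u v|u v].
- exact: comp_linearl.
- exact: comp_linearr.
- exact: id_compr.
- exact: id_compl.
Qed.

Definition quotCat : linCat k.
refine (@LinCat k A (fun X Y => quot_mod (I X Y))
  (fun X => quot_pi (I X X) (idm X)) quot_comp _ _ _ _ _).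
Proof.
- move=> X Y f; have [{}f <-] := quot_pi_surj f.
  by rewrite quot_comp_pi comp1m.
- move=> X Y f; have [{}f <-] := quot_pi_surj f.
  by rewrite quot_comp_pi compm1.
- move=> X Y Z W h g f; have [{}f <-] := quot_pi_surj f.
  have [{}g <-] := quot_pi_surj g; have [{}h <-] := quot_pi_surj h.
  by rewrite !quot_comp_pi compA.
- move=> X Y Z f; apply: quot_lift2_linl => [v|u|u v|u v].
  + exact: comp_linearl.
  + exact: comp_linearr.
  + exact: id_compr.
  + exact: id_compl.
- move=> X Y Z g; apply: quot_lift2_linr => [v|u|u v|u v].
  + exact: comp_linearl.
  + exact: comp_linearr.
  + exact: id_compr.
  + exact: id_compl.
Defined.

Definition quot_hom (X Y : A) (f : hom X Y) : hom (X : quotCat) Y :=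
  quot_pi (I X Y) f.

Lemma quot_homM (X Y Z : A) (g : hom Y Z) (f : hom X Y) :
  quot_hom (g \oc f) = quot_hom g \oc quot_hom f.
Proof. by rewrite -[RHS]/(quot_comp _ _) quot_comp_pi. Qed.

Lemma quot_hom_surj (X Y : quotCat) (q : hom X Y) :
  exists f : @hom k A X Y, quot_hom f = q.
Proof. exact: quot_pi_surj. Qed.

Lemma quot_hom_bwdK (X Y : A) (s : iso X Y) :
  quot_hom (bwd s) \oc quot_hom s = idm (X : quotCat).
Proof. by rewrite -quot_homM bwdK. Qed.

Lemma quot_hom_fwdK (X Y : A) (s : iso X Y) :
  quot_hom s \oc quot_hom (bwd s) = idm (Y : quotCat).
Proof. by rewrite -quot_homM fwdK. Qed.

Definition quot_iso (X Y : A) (s : iso X Y) : iso (X : quotCat) Y :=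
  Iso (quot_hom_bwdK s) (quot_hom_fwdK s).

End QuotCat.

Record biideal (k : fieldType) (C : bicat k) := Biideal {
  bi_id :> forall i j : C, ideal (mor1 i j);
  bi_hcompl : forall i j l (G G' : mor1 j l) (F F' : mor1 i j)
    (b : hom G G') (a : hom F F'), a \in sub_pred (bi_id i j F F') ->
    b \o2 a \in sub_pred (bi_id i l (G \o1 F) (G' \o1 F'));
  bi_hcompr : forall i j l (G G' : mor1 j l) (F F' : mor1 i j)
    (b : hom G G') (a : hom F F'), b \in sub_pred (bi_id j l G G') ->
    b \o2 a \in sub_pred (bi_id i l (G \o1 F) (G' \o1 F')) }.

Section QuotBicat.
Variables (k : fieldType) (C : bicat k) (I : biideal C).
Local Notation quo i j := (quotCat (I i j)).

Definition quot_hcomp2 (i j l : C) (G G' : quo j l) (F F' : quo i j) :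
  hom G G' -> hom F F' ->
  hom ((hcomp G F : mor1 i l) : quo i l) (hcomp G' F' : mor1 i l) :=
  quot_lift2 (I i l (hcomp G F) (hcomp G' F'))
    (fun (b : @hom k (mor1 j l) G G') (a : @hom k (mor1 i j) F F') =>
      b \o2 a).

Lemma quot_hcomp2_pi (i j l : C) (G G' : mor1 j l) (F F' : mor1 i j)
  (b : hom G G') (a : hom F F') :
  quot_hcomp2 (quot_hom (I j l) b) (quot_hom (I i j) a)
  = quot_hom (I i l) (b \o2 a).
Proof.
apply: quot_lift2_pi => [v|u|u v|u v].
- exact: hcomp2_linearl.
- exact: hcomp2_linearr.
- exact: bi_hcompr.
- exact: bi_hcompl.
Qed.

Definition quotBicat : bicat k.
refine (@Bicat k C (fun i j => quo i j) (fun i => id1 i)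
  (fun i j l G F => (hcomp (G : mor1 j l) (F : mor1 i j)))
  quot_hcomp2 _ _ _ _
  (fun i j l m H G F => quot_iso (I i m) (assoc H G F))
  (fun i j F => quot_iso (I i j) (lunit F))
  (fun i j F => quot_iso (I i j) (runit F)) _ _ _ _ _).
Proof.
- by move=> i j l G F; rewrite quot_hcomp2_pi hcomp2_id.
- move=> i j l G G' G'' F F' F'' b' b a' a.
  have [{}b <-] := quot_hom_surj b; have [{}b' <-] := quot_hom_surj b'.
  have [{}a <-] := quot_hom_surj a; have [{}a' <-] := quot_hom_surj a'.
  by rewrite -2!quot_homM !quot_hcomp2_pi -quot_homM hcomp2_comp.
- move=> i j l G G' F F' a; apply: quot_lift2_linl => [v|u|u v|u v].
  + exact: hcomp2_linearl.
  + exact: hcomp2_linearr.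
  + exact: bi_hcompr.
  + exact: bi_hcompl.
- move=> i j l G G' F F' b; apply: quot_lift2_linr => [v|u|u v|u v].
  + exact: hcomp2_linearl.
  + exact: hcomp2_linearr.
  + exact: bi_hcompr.
  + exact: bi_hcompl.
- move=> i j l m H H' G G' F F' c b a.
  have [{}b <-] := quot_hom_surj b; have [{}c <-] := quot_hom_surj c.
  have [{}a <-] := quot_hom_surj a.
  by rewrite !quot_hcomp2_pi -!quot_homM assoc_nat.
- move=> i j F F' a; have [{}a <-] := quot_hom_surj a.
  by rewrite quot_hcomp2_pi -!quot_homM lunit_nat.
- move=> i j F F' a; have [{}a <-] := quot_hom_surj a.
  by rewrite quot_hcomp2_pi -!quot_homM runit_nat.
- move=> i j l m n K H G F.
  have := congr1 (@quot_hom _ _ (I i n) _ _) (pentagon K H G F).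
  by rewrite !quot_homM -!quot_hcomp2_pi.
- move=> i j l G F; have := congr1 (@quot_hom _ _ (I i l) _ _) (triangle G F).
  by rewrite !quot_homM -!quot_hcomp2_pi.
Defined.

End QuotBicat.

Section HcompZero.
Variables (k : fieldType) (C : bicat k) (i j l : C).
Variables (G G' : mor1 j l) (F F' : mor1 i j).

Lemma hcomp20 (b : hom G G') : b \o2 (0 : hom F F') = 0.
Proof. exact: (linear_0 (hcomp2_linearr b)). Qed.

Lemma hcomp02 (a : hom F F') : (0 : hom G G') \o2 a = 0.
Proof. exact: (linear_0 (hcomp2_linearl a)). Qed.

End HcompZero.

Section Annihilator.
Variables (k : fieldType) (C D : bicat k) (M : pseudofunctor C D).

Definition ann_pred (i j : C) (F G : mor1 i j) : pred (hom F G) :=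
  fun a => fmap (pf1 M) a == 0.

Lemma ann_closed (i j : C) (F G : mor1 i j) :
  submod_closed (ann_pred (F := F) (G := G)).
Proof.
split=> [|c a b]; rewrite !unfold_in /ann_pred ?linear0 //.
by move=> /eqP a0 /eqP b0; rewrite linearP a0 b0 scaler0 addr0.
Qed.

Definition ann_sub (i j : C) (F G : mor1 i j) : submodule (hom F G) :=
  Submodule (@ann_closed i j F G).

Lemma ann_compl (i j : C) (F G H : mor1 i j) (b : hom G H) (a : hom F G) :
  a \in sub_pred (ann_sub F G) -> b \oc a \in sub_pred (ann_sub F H).
Proof.
by rewrite !unfold_in /ann_pred => /eqP a0; rewrite fmapM a0 comp0r.
Qed.

Lemma ann_compr (i j : C) (F G H : mor1 i j) (b : hom G H) (a : hom F G) :
  b \in sub_pred (ann_sub G H) -> b \oc a \in sub_pred (ann_sub F H).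
Proof.
by rewrite !unfold_in /ann_pred => /eqP b0; rewrite fmapM b0 comp0l.
Qed.

Definition ann_ideal (i j : C) : ideal (mor1 i j) :=
  Ideal (@ann_compl i j) (@ann_compr i j).

Lemma fmap_hcomp0 (i j l : C) (G G' : mor1 j l) (F F' : mor1 i j)
  (b : hom G G') (a : hom F F') :
  fmap (pf1 M) b \o2 fmap (pf1 M) a = 0 -> fmap (pf1 M) (b \o2 a) = 0.
Proof.
move=> ba0; rewrite -[LHS]compm1 -(fwdK (pf_comp M G F)) compA -pf_comp_nat.
by rewrite ba0 comp0r comp0l.
Qed.

Lemma ann_hcompl (i j l : C) (G G' : mor1 j l) (F F' : mor1 i j)
  (b : hom G G') (a : hom F F') : a \in sub_pred (ann_ideal i j F F') ->
  b \o2 a \in sub_pred (ann_ideal i l (G \o1 F) (G' \o1 F')).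
Proof.
rewrite !unfold_in /ann_pred => /eqP a0; apply/eqP/fmap_hcomp0.
by rewrite a0 hcomp20.
Qed.

Lemma ann_hcompr (i j l : C) (G G' : mor1 j l) (F F' : mor1 i j)
  (b : hom G G') (a : hom F F') : b \in sub_pred (ann_ideal j l G G') ->
  b \o2 a \in sub_pred (ann_ideal i l (G \o1 F) (G' \o1 F')).
Proof.
rewrite !unfold_in /ann_pred => /eqP b0; apply/eqP/fmap_hcomp0.
by rewrite b0 hcomp02.
Qed.

Definition annihilator : biideal C := Biideal ann_hcompl ann_hcompr.

End Annihilator.

Definition birep (k : fieldType) (C : bicat k) := pseudofunctor C (afBicat k).

Section Birep.
Variables (k : fieldType) (C : bicat k) (M : birep C).

Definition bcat (i : C) : linCat k := af_cat (pf0 M i).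

Definition bact (i j : C) (F : mor1 i j) (X : bcat i) : bcat j :=
  fob (pf1 M F : linFun (bcat i) (bcat j)) X.

Definition transitive_birep :=
  (exists i (X : bcat i), ~ is_zero X) /\
  forall i (X : bcat i), ~ is_zero X -> forall j (Y : bcat j),
    add_closure [set bact F X | F in [set: mor1 i j]] Y.

End Birep.

Section Cells.
Variables (k : fieldType) (C : bicat k).

Record mor := Mor { src : C; tgt : C; mor_of :> mor1 src tgt }.

Definition J_ge (F G : mor) := exists (H : mor1 (tgt G) (tgt F))
  (H' : mor1 (src F) (src G)), direct_summand F (H \o1 (G \o1 H')).

Definition J_equiv (F G : mor) := J_ge F G /\ J_ge G F.

(* Families of 1-morphisms are plain predicates: the sets of
   classical_sets live in too small a universe to range over the 1-morphisms
   of a bicategory such as afBicat. *)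
Definition J_cell (F : mor) : mor -> Prop :=
  fun G => indecomposable G /\ J_equiv F G.

Definition two_sided_cell (J : mor -> Prop) :=
  exists F : mor, indecomposable F /\ J = J_cell F.

Definition cell_le (J J' : mor -> Prop) :=
  exists F G : mor, [/\ J F, J' G & J_ge G F].

Definition J_artinian := forall J : nat -> mor -> Prop,
  (forall n, two_sided_cell (J n)) -> (forall n, cell_le (J n) (J n.+1)) ->
  exists N, forall n, (N <= n)%N -> J n = J N.

Definition maximal_cell (J : mor -> Prop) := two_sided_cell J /\
  forall J', two_sided_cell J' -> cell_le J J' -> J' = J.

End Cells.

Definition quot_by_ann (k : fieldType) (C D : bicat k)
  (M : pseudofunctor C D) : bicat k := quotBicat (annihilator M).

(* Main.v *)
(* Call a 1-morphism of C with local endomorphism ring surviving if it is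
   nonzero in C_M.  Locality lets one lift retractions onto it from C_M to C, so
   the J-preorder between surviving 1-morphisms is the same in C and in C_M, and
   every indecomposable of C_M is isomorphic to a surviving one.  Hence C_M
   inherits the ascending chain condition and has a maximal cell.

   For uniqueness let F and G lie in maximal cells and choose X with FX nonzero.
   By transitivity every object Y with GY nonzero is a summand of a sum of
   objects HFX, so GHFX is nonzero for some H.  Then GHF is nonzero in C_M, and
   an indecomposable summand of it lies above both F and G, hence in both
   cells. *)

From mathcomp Require Import all_boot all_order all_algebra.
From mathcomp Require Import boolp classical_sets.
Require Import Defs.

Set Implicit Arguments.
Unset Strict Implicit.
Unset Printing Implicit Defensive.

Import GRing.Theory.
Local Open Scope ring_scope.
Local Open Scope bicat_scope.

(** * Retracts, local endomorphism rings and direct summands in a linear category *)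

Definition retract (k : fieldType) (A : linCat k) (Y X : A) :=
  exists (i : hom Y X) (p : hom X Y), p \oc i = idm Y.

Section LinCat.
Variables (k : fieldType) (A : linCat k).
Implicit Types X Y Z : A.

Lemma is_zeroP X : is_zero X <-> idm X = 0.
Proof.
split=> [X0|X0 Y]; first exact: (X0 X).1.
by split=> f; [rewrite -[f]compm1|rewrite -[f]comp1m];
  rewrite X0 ?comp0l ?comp0r.
Qed.

Lemma comp_suml X Y Z (I : Type) (r : seq I) (P : pred I)
    (g : I -> hom Y Z) (f : hom X Y) :
  (\sum_(a <- r | P a) g a) \oc f = \sum_(a <- r | P a) (g a \oc f).
Proof.
by apply: (big_morph (fun h : hom Y Z => h \oc f)) => [g1 g2|];
  rewrite ?compDl ?comp0l.
Qed.

Lemma comp_sumr X Y Z (I : Type) (r : seq I) (P : pred I)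
    (g : hom Y Z) (f : I -> hom X Y) :
  g \oc (\sum_(a <- r | P a) f a) = \sum_(a <- r | P a) (g \oc f a).
Proof.
by apply: (big_morph (fun h : hom X Y => g \oc h)) => [f1 f2|];
  rewrite ?compDr ?comp0r.
Qed.

Lemma retract_trans X Y Z : retract Z Y -> retract Y X -> retract Z X.
Proof.
move=> [i [p pi]] [j [q qj]]; exists (j \oc i), (p \oc q).
by rewrite -compA (compA q) qj comp1m.
Qed.

Lemma iso_retract X Y : iso X Y -> retract X Y.
Proof. by move=> s; exists s, (bwd s); rewrite bwdK. Qed.

Lemma retract_refl X : retract X X.
Proof. exact: iso_retract (id_iso X). Qed.

Definition iso_sym X Y (s : iso X Y) : iso Y X := Iso (fwdK s) (bwdK s).

Lemma summand_retract X Y : direct_summand Y X -> retract Y X.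
Proof. by move=> [Z [i [_ [p [_ [pi _ _ _ _]]]]]]; exists i, p. Qed.

Lemma iso_summand X Y Z : iso Z Y -> direct_summand Y X -> direct_summand Z X.
Proof.
move=> s [W [i [j [p [q [pi qj pj qi e]]]]]]; exists W.
exists (i \oc s), j, (bwd s \oc p), q; split=> //.
- by rewrite -compA (compA p) pi comp1m bwdK.
- by rewrite -compA pj comp0r.
- by rewrite compA qi comp0l.
- by rewrite -compA (compA (fwd s)) fwdK comp1m.
Qed.

Lemma retract_neq0 X Y : retract Y X -> idm Y <> 0 -> idm X <> 0.
Proof.
by move=> [i [p pi]] Y0 X0; apply: Y0; rewrite -pi -[p]compm1 X0 comp0r comp0l.
Qed.

Lemma invertible1 X : invertible (idm X).
Proof. by exists (idm X); rewrite comp1m. Qed.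

Lemma invertible_sides X Y (f : hom X Y) (g h : hom Y X) :
  g \oc f = idm X -> f \oc h = idm Y -> invertible f.
Proof.
move=> gf fh; exists g; split=> //.
by rewrite -[g]compm1 -fh (compA g) gf comp1m.
Qed.

Lemma local_end_sum X (n : nat) (f : 'I_n -> hom X X) :
  local_end X -> invertible (\sum_a f a) -> exists a, invertible (f a).
Proof.
move=> [X0 Xloc]; elim: n f => [|n IH] f.
  by rewrite big_ord0 => -[g [+ _]]; rewrite comp0r => /esym.
rewrite big_ord_recl => /Xloc[f0|/IH[a fa]]; first by exists ord0.
by exists (lift ord0 a).
Qed.

(** By locality [i \oc p] or its complement is invertible, and an invertible idempotent is the
    identity; the complement being the identity would force [idm Y = 0]. *)
Lemma local_end_retract_iso X Y :
  idm Y <> 0 -> local_end X -> retract Y X -> inhabited (iso Y X).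
Proof.
move=> Y0 [X0 Xloc] [i [p pi]]; have ipip : (i \oc p) \oc (i \oc p) = i \oc p.
  by rewrite compA -(compA i) pi compm1.
have: invertible (i \oc p + (idm X - i \oc p)).
  by rewrite addrC subrK; exact: invertible1.
case/Xloc => [[g [gip _]]|[g [gip _]]].
  constructor; apply: (@Iso _ _ _ _ i p) => //.
  by rewrite -[LHS]comp1m -gip -compA ipip.
have ip0 : i \oc p = 0.
  by rewrite -[LHS]comp1m -gip -compA compBl comp1m ipip subrr comp0r.
by case: Y0; rewrite -[LHS]comp1m -pi -compA (compA i) ip0 comp0l comp0r.
Qed.

(** The two idempotents of a biproduct sum to the identity, so one is invertible; the other
    projection kills it and is therefore zero. *)
Lemma local_end_indecomposable X : local_end X -> indecomposable X.
Proof.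
move=> [X0 Xloc]; split=> [/is_zeroP//|Y Z [iY [iZ [pY [pZ]]]]].
move=> [pYi pZi pYiZ pZiY e]; have: invertible (iY \oc pY + iZ \oc pZ).
  by rewrite e; exact: invertible1.
case/Xloc => -[g [_ eg]]; [right|left]; apply/is_zeroP.
  by rewrite -pZi -[pZ]compm1 -eg (compA _ _ g) compA pZiY !comp0l.
by rewrite -pYi -[pY]compm1 -eg (compA _ _ g) compA pYiZ !comp0l.
Qed.

(* The complement is built by induction on the set of summands, as the
   splitting of a partial sum of the idempotents [i a \oc p a]. *)
Lemma direct_sum_summand X (n : nat) (Xs : 'I_n -> A) a :
  additive_cat A -> is_direct_sum X Xs -> direct_summand (Xs a) X.
Proof.
move=> [[O /is_zeroP O0] sums] [i [p [pi1 pi0 e]]].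
have orthl (b : 'I_n) s : b \notin s ->
    p b \oc \sum_(c <- s) (i c \oc p c) = 0.
  move=> bs; rewrite comp_sumr big_seq big1 // => c cs.
  by rewrite compA pi0 ?comp0l //; apply: contraNneq bs => ->.
have orthr (b : 'I_n) s : b \notin s ->
    (\sum_(c <- s) (i c \oc p c)) \oc i b = 0.
  move=> bs; rewrite comp_suml big_seq big1 // => c cs.
  by rewrite -compA pi0 ?comp0r //; apply: contraNneq bs => <-.
have zerol b s Z (u : hom Z X) (v : hom X Z) : b \notin s ->
    v \oc u = idm Z -> u \oc v = \sum_(c <- s) (i c \oc p c) ->
    p b \oc u = 0 /\ v \oc i b = 0.
  move=> bs vu uv; split.
    by rewrite -[u]compm1 -vu (compA u) uv compA orthl // comp0l.
  by rewrite -[v]comp1m -vu -(compA v) uv -compA orthr // comp0r.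
have split_idem (s : seq 'I_n) : uniq s -> exists (Z : A) (u : hom Z X)
    (v : hom X Z), v \oc u = idm Z /\ u \oc v = \sum_(b <- s) (i b \oc p b).
  elim: s => [|b s IH] /=.
    by exists O, 0, 0; rewrite big_nil O0 !comp0l.
  case/andP=> bs /IH[Z [u [v [vu uv]]]].
  have [pu vi] := zerol _ _ _ _ _ bs vu uv.
  have [W [jb [jZ [qb [qZ [qjb qjZ qbjZ qZjb eW]]]]]] := sums (Xs b) Z.
  exists W, (i b \oc qb + u \oc qZ), (jb \oc p b + jZ \oc v); split.
    rewrite -eW !compDl !compDr -!compA.
    rewrite (compA (p b)) pi1 comp1m (compA (p b)) pu comp0l comp0r addr0.
    by rewrite (compA v) vi comp0l comp0r add0r (compA v) vu comp1m.
  rewrite big_cons -uv !compDl !compDr -!compA.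
  rewrite (compA qb) qjb comp1m (compA qb) qbjZ comp0l comp0r addr0.
  by rewrite (compA qZ) qZjb comp0l comp0r add0r (compA qZ) qjZ comp1m.
set s := [seq b <- index_enum 'I_n | b != a].
have [Z [u [v [vu uv]]]] := split_idem s (filter_uniq _ (index_enum_uniq _)).
have [|pu vi] := zerol a _ _ _ _ _ vu uv; first by rewrite mem_filter eqxx.
exists Z, (i a), u, (p a), v; split=> //.
by rewrite uv big_filter -e [RHS](bigD1 a).
Qed.

(** The identity of [Y] is a sum of endomorphisms through the local summands of [X]; one of these is
    invertible, which makes [Y] isomorphic to that summand. *)
Lemma local_end_retract_summand X Y :
  additive_cat A -> krull_schmidt A ->
  local_end Y -> retract Y X -> direct_summand Y X.
Proof.
move=> add KS Yloc [f [g gf]]; have [n [Xs [Xloc dX]]] := KS X.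
have [i [p [_ _ e]]] := dX.
have: invertible (\sum_a (g \oc (i a \oc p a) \oc f)).
  by rewrite -comp_suml -comp_sumr e compm1 gf; exact: invertible1.
case/(local_end_sum Yloc) => a [h [hg _]].
have [|s] := @local_end_retract_iso (Xs a) Y Yloc.1 (Xloc a).
  by exists (p a \oc f), (h \oc (g \oc i a)); rewrite -hg -!compA.
exact: iso_summand s (direct_sum_summand a add dX).
Qed.

End LinCat.

(** * Quotients by an ideal: lifting invertibility, retractions and decompositions *)

Section QuotCat.
Variables (k : fieldType) (A : linCat k) (I : ideal A).
Local Notation Q := (quotCat I).
Implicit Types X Y Z : A.

Lemma quot_homD X Y (f g : hom X Y) :
  quot_hom I (f + g) = quot_hom I f + quot_hom I g.
Proof. exact: quot_piD. Qed.

Lemma quot_hom0 X Y : quot_hom I (0 : hom X Y) = 0.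
Proof. exact: (linear_0 (quot_pi_linear (I X Y))). Qed.

Lemma quot_homB X Y (f g : hom X Y) :
  quot_hom I (f - g) = quot_hom I f - quot_hom I g.
Proof. exact: (linear_B (quot_pi_linear (I X Y))). Qed.

Lemma quot_hom0P X Y (f : hom X Y) :
  quot_hom I f = 0 <-> f \in sub_pred (I X Y).
Proof. by rewrite -[f in f \in _]subr0 -quot_piP -(quot_hom0 X Y). Qed.

Lemma quot_hom1 X : quot_hom I (idm X) = idm (X : Q).
Proof. by []. Qed.

Lemma retract_quot X Y : retract Y X -> retract (Y : Q) X.
Proof.
move=> [i [p pi]]; exists (quot_hom I i), (quot_hom I p).
by rewrite -quot_homM pi.
Qed.

Lemma summand_quot X Y : direct_summand Y X -> direct_summand (Y : Q) X.
Proof.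
move=> [Z [i [j [p [q [pi qj pj qi e]]]]]]; exists Z.
exists (quot_hom I i), (quot_hom I j), (quot_hom I p), (quot_hom I q).
by split; rewrite -!quot_homM ?pi ?qj ?pj ?qi -?quot_homD ?e ?quot_hom0.
Qed.

(** Locality makes [f] or [idm X - f] invertible, and the latter maps to zero in the quotient, where
    [X] is nonzero. *)
Lemma quot_hom_idm_invertible X (f : hom X X) :
  local_end X -> idm (X : Q) <> 0 -> quot_hom I f = idm (X : Q) ->
  invertible f.
Proof.
move=> [_ Xloc] X0 f1; have: invertible (f + (idm X - f)).
  by rewrite addrC subrK; exact: invertible1.
case/Xloc => // -[g [gf _]]; case: X0.
by rewrite -quot_hom1 -gf quot_homM quot_homB f1 quot_hom1 subrr comp0r.
Qed.

(** The lift of [p \oc i] is only congruent to the identity, but it is invertible, so [p] can be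
    corrected by its inverse. *)
Lemma retract_of_quot X Y :
  local_end Y -> idm (Y : Q) <> 0 -> retract (Y : Q) X -> retract Y X.
Proof.
move=> Yloc Y0 [i [p]]; have [{}i <-] := quot_hom_surj i.
have [{}p <-] := quot_hom_surj p; rewrite -quot_homM => pi.
have [g [gpi _]] := quot_hom_idm_invertible Yloc Y0 pi.
by exists i, (g \oc p); rewrite -compA.
Qed.

(** If [h] lifts an inverse of [f + g], then [h \oc (f + g)] and [(f + g) \oc h] are congruent to
    the identity, hence invertible, so [f + g] is invertible already before passing to the
    quotient. *)
Lemma local_end_quot X :
  local_end X -> idm (X : Q) <> 0 -> local_end (X : Q).
Proof.
move=> Xloc X0; split=> // f g.
have [{}f <-] := quot_hom_surj f; have [{}g <-] := quot_hom_surj g.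
move=> [h]; have [{}h <-] := quot_hom_surj h; rewrite -quot_homD -!quot_homM.
have inv (l : hom X X) : invertible l -> invertible (quot_hom I l).
  by move=> [m [ml lm]]; exists (quot_hom I m); rewrite -!quot_homM ml lm.
move=> [/(quot_hom_idm_invertible Xloc X0)[u [u1 _]]].
move=> /(quot_hom_idm_invertible Xloc X0)[v [_ v1]].
have [|/inv|/inv] := Xloc.2 f g; [|by left|by right].
by apply: (@invertible_sides _ _ _ _ _ (u \oc h) (h \oc v));
  rewrite -?compA // compA.
Qed.

(** The identity of [X] is a sum of morphisms through local summands, so these cannot all vanish in
    the quotient. *)
Lemma quot_neq0_local_summand X :
  additive_cat A -> krull_schmidt A -> idm (X : Q) <> 0 ->
  exists2 Y, direct_summand Y X & local_end Y /\ idm (Y : Q) <> 0.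
Proof.
move=> add KS X0; have [n [Xs [Xloc dX]]] := KS X.
have [i [p [_ _ e]]] := dX.
have [a Xa0] : exists a, idm (Xs a : Q) <> 0.
  apply/existsNP => Xs0; apply: X0; rewrite -quot_hom1 -e.
  apply: (big_ind (fun f => quot_hom I f = 0)) => [|f g|a _].
  - exact: quot_hom0.
  - by rewrite quot_homD => -> ->; rewrite addr0.
  - by rewrite quot_homM -[quot_hom I (i a)]compm1 Xs0 comp0r comp0l.
by exists (Xs a); [exact: direct_sum_summand|].
Qed.

(** A local summand that stays nonzero has zero complement in the quotient, so its projection
    becomes an isomorphism. *)
Lemma quot_indecomposable_iso X :
  additive_cat A -> krull_schmidt A -> indecomposable (X : Q) ->
  exists Y, [/\ local_end Y, idm (Y : Q) <> 0 & inhabited (iso (X : Q) Y)].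
Proof.
move=> add KS [X0 Xind].
have [|Y dY [Yloc Y0]] := quot_neq0_local_summand add KS (X := X).
  by move=> /is_zeroP.
exists Y; split=> //; have [Z bXYZ] := summand_quot dY.
have [/is_zeroP//|Z0] := Xind _ _ bXYZ.
have [i [j [p [q [pi _ _ _ e]]]]] := bXYZ.
constructor; apply: (@Iso _ _ _ _ p i) => //.
by rewrite -e ((Z0 X).1 j) comp0l addr0.
Qed.

End QuotCat.

(** * The J-preorder through retracts *)

Section JOrder.
Variables (k : fieldType) (C : bicat k).
Implicit Types F G H : mor C.

(* The J-preorder with retracts in place of direct summands: this version is
   transitive without any hypothesis on the hom categories. *)
Definition J_retract F G := exists (H : mor1 (tgt G) (tgt F))
  (H' : mor1 (src F) (src G)), retract (mor_of F) (H \o1 (G \o1 H')).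

Lemma retract_hcomp (i j l : C) (G G' : mor1 j l) (F F' : mor1 i j) :
  retract G G' -> retract F F' -> retract (G \o1 F) (G' \o1 F').
Proof.
move=> [u [v vu]] [s [t ts]]; exists (u \o2 s), (v \o2 t).
by rewrite -hcomp2_comp vu ts hcomp2_id.
Qed.

Lemma J_ge_retract F G : J_ge F G -> J_retract F G.
Proof. by move=> [H [H' /summand_retract FG]]; exists H, H'. Qed.

Lemma retract_J_retract (i j : C) (F G : mor1 i j) :
  retract F G -> J_retract (Mor F) (Mor G).
Proof.
move=> FG; exists (id1 j), (id1 i); apply: (retract_trans FG) => /=.
apply: retract_trans (iso_retract (iso_sym (runit G))) _.
exact: iso_retract (iso_sym (lunit _)).
Qed.

Lemma J_retract_refl F : J_retract F F.
Proof. by case: F => i j F; exact/retract_J_retract/retract_refl. Qed.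

Lemma J_retract_trans F G H :
  J_retract F G -> J_retract G H -> J_retract F H.
Proof.
move=> [L [L' FG]] [K [K' GH]]; exists (L \o1 K), (K' \o1 L').
apply: (retract_trans FG).
apply: (@retract_trans _ _ _ (L \o1 (K \o1 (H \o1 (K' \o1 L'))))); last first.
  exact: iso_retract (iso_sym (assoc _ _ _)).
apply: retract_hcomp; first exact: retract_refl.
apply: (@retract_trans _ _ _ ((K \o1 (H \o1 K')) \o1 L')).
  exact: retract_hcomp GH (retract_refl _).
apply: retract_trans (iso_retract (assoc _ _ _)) _.
apply: retract_hcomp (retract_refl _) (iso_retract (assoc _ _ _)).
Qed.

Lemma J_retract_hcomp_l (i j l : C) (G : mor1 j l) (F : mor1 i j) :
  J_retract (Mor (G \o1 F)) (Mor F).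
Proof.
exists G, (id1 i) => /=; apply: retract_hcomp (retract_refl _) _.
exact: iso_retract (iso_sym (runit F)).
Qed.

Lemma J_retract_hcomp_r (i j l : C) (G : mor1 j l) (F : mor1 i j) :
  J_retract (Mor (G \o1 F)) (Mor G).
Proof. by exists (id1 l), F => /=; exact: iso_retract (iso_sym (lunit _)). Qed.

End JOrder.

(** * Cells of the quotient bicategory and existence of a maximal one *)

Section QuotBicat.
Variables (k : fieldType) (C : bicat k) (I : biideal C).
Hypothesis C_add : forall i j : C, additive_cat (mor1 i j).
Hypothesis C_KS : forall i j : C, krull_schmidt (mor1 i j).
Local Notation Q := (quotBicat I).

Definition quot_mor (F : mor C) : mor Q :=
  @Mor k Q (src F) (tgt F) (mor_of F).

Definition surviving (F : mor C) :=
  local_end (mor_of F) /\ idm (mor_of (quot_mor F)) <> 0.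

Lemma surviving_indecomposable (F : mor C) :
  surviving F -> indecomposable (mor_of (quot_mor F)).
Proof.
by move=> [Floc F0]; exact: local_end_indecomposable (local_end_quot Floc F0).
Qed.

(** The retraction lifts to [C], where Krull-Schmidt decompositions turn it into a summand; summands
    then descend to the quotient. *)
Lemma surviving_J_ge (F : mor C) (G : mor Q) :
  surviving F -> J_retract (quot_mor F) G -> J_ge (quot_mor F) G.
Proof.
move=> [Floc F0] [H [H' FG]]; exists H, H'; apply: summand_quot.
exact: local_end_retract_summand (retract_of_quot Floc F0 FG).
Qed.

Lemma surviving_J_ge_quotP (F G : mor C) :
  surviving F -> J_ge (quot_mor F) (quot_mor G) <-> J_ge F G.
Proof.
move=> sF; have [Floc F0] := sF; split.
  move=> /J_ge_retract[H [H' FG]]; exists H, H'.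
  exact: local_end_retract_summand (retract_of_quot Floc F0 FG).
by move=> [H [H' FG]]; exists H, H'; exact: summand_quot FG.
Qed.

(** [F'] is isomorphic to [F] in the quotient; the last clause holds since a summand may be replaced
    by an isomorphic object. *)
Lemma quot_indecomposable_surviving (F : mor Q) :
  indecomposable (mor_of F) -> exists F' : mor C, [/\ surviving F',
    J_retract F (quot_mor F'), J_retract (quot_mor F') F
    & forall G : mor Q, J_ge (quot_mor F') G -> J_ge F G].
Proof.
case: F => i j F Find.
have [F' [loc F'0 [s]]] :=
  quot_indecomposable_iso (C_add i j) (@C_KS i j) Find.
exists (@Mor k C i j F'); split=> //.
- exact/retract_J_retract/(iso_retract s).
- exact/retract_J_retract/(iso_retract (iso_sym s)).
- by move=> G [H [H' F'G]]; exists H, H'; exact: iso_summand s F'G.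
Qed.

(** Makes [J_ge] a preorder on the indecomposables of the quotient, as [J_retract] is one. *)
Lemma quot_J_geP (F G : mor Q) :
  indecomposable (mor_of F) -> J_ge F G <-> J_retract F G.
Proof.
move=> Find; split; first exact: J_ge_retract.
move=> FG; have [F' [sF' _ F'F up]] := quot_indecomposable_surviving Find.
exact/up/surviving_J_ge/(J_retract_trans F'F).
Qed.

Lemma quot_J_cell_eq (F G : mor Q) :
  indecomposable (mor_of F) -> indecomposable (mor_of G) ->
  J_retract F G -> J_retract G F -> J_cell F = J_cell G.
Proof.
have sub (F' G' : mor Q) H : indecomposable (mor_of F') ->
    indecomposable (mor_of G') -> J_retract F' G' -> J_retract G' F' ->
    J_cell F' H -> J_cell G' H.
  move=> Find Gind FG GF [Hind [/quot_J_geP-/(_ Find) FH]].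
  move=> /quot_J_geP-/(_ Hind) HF; split=> //.
  by split; apply/quot_J_geP => //; [apply: J_retract_trans GF FH|
    apply: J_retract_trans HF FG].
by move=> Find Gind FG GF; apply/predeqP => H; split; exact: sub.
Qed.

Lemma quot_J_cell_refl (F : mor Q) :
  indecomposable (mor_of F) -> J_cell F F.
Proof. by move=> Find; split=> //; split; apply/quot_J_geP/J_retract_refl. Qed.

Lemma quot_maximal_cell_eq (F K : mor Q) :
  indecomposable (mor_of F) -> indecomposable (mor_of K) ->
  maximal_cell (J_cell F) -> J_retract K F -> J_cell K = J_cell F.
Proof.
move=> Find Kind [_ Fmax] KF; apply: Fmax; first by exists K.
by exists F, K; split; [exact: quot_J_cell_refl..|apply/quot_J_geP].
Qed.

(** By contraposition: a cell above that of [F] has a surviving representative [G] with [J_ge G F]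
    in [C]; if [J_ge F G] holds for every such [G], the two cells agree. *)
Lemma surviving_above (F : mor C) : surviving F ->
  ~ maximal_cell (J_cell (quot_mor F)) ->
  exists G : mor C, [/\ surviving G, J_ge G F & ~ J_ge F G].
Proof.
move=> sF; apply: contra_notP => noG.
have Find := surviving_indecomposable sF.
split; first by exists (quot_mor F).
move=> _ [G0 [G0ind ->]] [F1 [G1 [[F1ind [FF1 F1F]] [G1ind [G0G1 G1G0]] G1F1]]].
have [G [sG G0G GG0 _]] := quot_indecomposable_surviving G0ind.
have {}G0F : J_retract G0 (quot_mor F).
  apply: J_retract_trans (J_ge_retract G0G1) _.
  exact: J_retract_trans (J_ge_retract G1F1) (J_ge_retract F1F).
have GF : J_ge G F.
  exact/surviving_J_ge_quotP/surviving_J_ge/(J_retract_trans GG0).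
apply: quot_J_cell_eq => //; apply: contra_notP noG => nFG0.
exists G; split=> // FG; apply: nFG0.
have /J_ge_retract FGQ : J_ge (quot_mor F) (quot_mor G).
  exact/surviving_J_ge_quotP.
exact: J_retract_trans FGQ GG0.
Qed.

(** Without a maximal cell, iterating [surviving_above] gives a strictly ascending sequence of
    surviving 1-morphisms; its cells are formed in [C], where chains stabilize. *)
Lemma quot_maximal_cell_exists : J_artinian C ->
  (exists F : mor Q, idm (mor_of F) <> 0) ->
  exists F : mor Q, indecomposable (mor_of F) /\ maximal_cell (J_cell F).
Proof.
move=> art [[i j F] F0]; apply: contrapT => nomax.
have [F' _ [F'loc F'0]] := quot_neq0_local_summand (C_add i j) (@C_KS i j) F0.
have step (G : {G : mor C | surviving G}) :
    exists H : {H : mor C | surviving H},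
    J_ge (sval H) (sval G) /\ ~ J_ge (sval G) (sval H).
  case: G => G sG; have [|H [sH HG GH]] := surviving_above sG.
    move=> Gmax; apply: nomax; exists (quot_mor G).
    by split=> //; exact: surviving_indecomposable.
  by exists (exist _ H sH).
have {step}[next nextP] := choice step.
have sF' : surviving (Mor F') by [].
pose sG n := iter n next (exist _ _ sF'); pose G n : mor C := sval (sG n).
have Gind n : indecomposable (mor_of (G n)).
  by apply: local_end_indecomposable; case: (svalP (sG n)).
have Gcell n : J_cell (G n) (G n).
  have GG : J_ge (G n) (G n).
    (* Reflexivity in [C] is obtained through the quotient from that of [J_retract]. *)
    by apply/surviving_J_ge_quotP/surviving_J_ge/J_retract_refl; exact: svalP.
  by split.
have [||N stable] := art (fun n => J_cell (G n)).
- by move=> n; exists (G n).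
- by move=> n; exists (G n), (G n.+1); split=> //; case: (nextP (sG n)).
(* Stability puts [G N.+1] in the cell of [G N], against strictness. *)
have [] := nextP (sG N) => _; apply.
have := Gcell N.+1; rewrite stable //; by case=> _ [].
Qed.

End QuotBicat.

(** * The quotient by the annihilator of a transitive birepresentation *)

Section Birep.
Variables (k : fieldType) (C : bicat k) (M : birep C).
Local Notation Q := (quot_by_ann M).

(** [F] vanishes in the quotient exactly when the identity transformation of its image under [M] is
    zero, which is tested on components. *)
Lemma quot_ann_idm_neq0 (i j : C) (F : mor1 i j) :
  idm (F : @mor1 k Q i j) <> 0 <-> exists X : bcat M i, idm (bact F X) <> 0.
Proof.
have -> : idm (F : @mor1 k Q i j) = 0 <-> idm (pf1 M F) = 0.
  rewrite -fmap1; split=> [/quot_hom0P/eqP//|F0].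
  by apply/quot_hom0P/eqP.
split=> [F0|[X X0] F0]; last first.
  by apply: X0; have := congr1 (fun t : natTrans _ _ => t X) F0.
apply/existsNP => X0; apply: F0; exact: natTrans_eq.
Qed.

Lemma nt_iso_component (A B : linCat k) (F G : linFun A B) (X : A) :
  iso (F : funCat A B) G -> iso (F X) (G X).
Proof.
case=> s t ts st; exists (nt s X) (nt t X).
- exact: (congr1 (fun t : natTrans _ _ => t X) ts).
- exact: (congr1 (fun t : natTrans _ _ => t X) st).
Qed.

Lemma bact_hcomp (i j l : C) (G : mor1 j l) (F : mor1 i j) (X : bcat M i) :
  iso (bact G (bact F X)) (bact (G \o1 F) X).
Proof. exact: nt_iso_component (pf_comp M G F). Qed.

Lemma bact_id1 (i : C) (X : bcat M i) : iso X (bact (id1 i) X).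
Proof. exact: nt_iso_component (pf_id M i). Qed.

Lemma bact_fmap0 (i j : C) (F : mor1 i j) (X Y : bcat M i) (f : hom X Y) :
  idm (bact F X) = 0 -> fmap (pf1 M F : linFun (bcat M i) (bcat M j)) f = 0.
Proof.
move=> FX0.
by rewrite -[LHS]compm1 [X in _ \oc X](FX0 : idm (fob _ _) = 0) comp0r.
Qed.

(** The identity of [bact F Y] is a sum of morphisms through the objects [bact F (Xs a)], so these
    cannot all be zero. *)
Lemma bact_add_closure_neq0 (i j : C) (F : mor1 i j) (S : set (bcat M i)) Y :
  add_closure S Y -> idm (bact F Y) <> 0 ->
  exists2 X, S X & idm (bact F X) <> 0.
Proof.
move=> [X [n [Xs [SX [i_ [p_ [_ _ e]]] /summand_retract[f [g gf]]]]]] FY0.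
have [a Fa0] : exists a, idm (bact F (Xs a)) <> 0.
  apply/existsNP => Fa0; apply: FY0.
  rewrite /bact -fmap1 -gf -[g]compm1 -e comp_sumr comp_suml linear_sum.
  rewrite big1 // => a _; rewrite !fmapM.
  by rewrite (bact_fmap0 (i_ a) (Fa0 a)) comp0l comp0r comp0l.
by exists (Xs a).
Qed.

Hypothesis M_transitive : transitive_birep M.

Lemma quot_ann_neq0 : exists F : mor Q, idm (mor_of F) <> 0.
Proof.
have [[i [X /is_zeroP X0]] _] := M_transitive.
exists (@Mor k Q i i (id1 i)); apply/quot_ann_idm_neq0; exists X.
exact: retract_neq0 (iso_retract (bact_id1 X)) X0.
Qed.

Lemma quot_ann_hcomp_neq0 (i j l m : C) (G : mor1 l m) (F : mor1 i j) :
  idm (G : @mor1 k Q l m) <> 0 -> idm (F : @mor1 k Q i j) <> 0 ->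
  exists H : mor1 j l, idm (G \o1 (H \o1 F) : @mor1 k Q i m) <> 0.
Proof.
move=> /quot_ann_idm_neq0[Y GY0] /quot_ann_idm_neq0[X FX0].
have FXn : ~ is_zero (bact F X) by move/is_zeroP.
have [_ [H _ <-] GHFX0] :=
  bact_add_closure_neq0 (M_transitive.2 _ _ FXn _ Y) GY0.
exists H; apply/quot_ann_idm_neq0; exists X.
apply: retract_neq0 (iso_retract (bact_hcomp _ _ _)) _.
move=> GHF0; apply: GHFX0.
(* The identity of [G] applied to [H (F X)] factors through [G] applied to [(H \o1 F) X], which is
   zero. *)
rewrite /bact -fmap1 -(bwdK (bact_hcomp H F X)) fmapM.
by rewrite (bact_fmap0 _ GHF0) comp0l.
Qed.

End Birep.

(** * Uniqueness of the maximal cell *)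

Theorem lemma3p7 (k : closedFieldType) (C : bicat k) (M : birep C)
  (C_af : almost_finitary_bicat C) (C_artinian : J_artinian C)
  (M_transitive : transitive_birep M) :
  exists! J : mor (quot_by_ann M) -> Prop, maximal_cell J.
Proof.
have [_ hom_af _] := C_af.
have add (i j : C) : additive_cat (mor1 i j) by case: (hom_af i j).
have KS (i j : C) : krull_schmidt (mor1 i j) by case: (hom_af i j).
have [F [Find Fmax]] := quot_maximal_cell_exists add KS C_artinian
  (quot_ann_neq0 M_transitive).
exists (J_cell F); split=> // J' Gmax.
have [[G [Gind J'G]] _] := Gmax; subst J'.
have nz (L : mor (quot_by_ann M)) :
    indecomposable (mor_of L) -> idm (mor_of L) <> 0.
  by move=> [+ _] => + /is_zeroP.
have [H GHF0] := quot_ann_hcomp_neq0 M_transitive (nz _ Gind) (nz _ Find).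
(* The summand is taken in [C]: having a local endomorphism ring there, it stays indecomposable in
   the quotient. *)
have [K KGHF [Kloc K0]] :=
  quot_neq0_local_summand (add _ _) (@KS _ _) GHF0.
have sK : surviving (annihilator M) (Mor K) by [].
have Kind := surviving_indecomposable sK.
have KGHF' : J_retract (quot_mor (annihilator M) (Mor K))
    (@Mor k (quot_by_ann M) _ _ (G \o1 (H \o1 F))).
  apply: (@retract_J_retract k (quot_by_ann M)).
  exact: (retract_quot _ (summand_retract KGHF)).
have KG := J_retract_trans KGHF' (J_retract_hcomp_r _ _).
have KF := J_retract_trans KGHF'
  (J_retract_trans (J_retract_hcomp_l _ _) (J_retract_hcomp_l _ _)).
(* By maximality both cells equal the cell of [K]. *)
rewrite -(quot_maximal_cell_eq add KS Find Kind Fmax KF).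
exact: quot_maximal_cell_eq Gmax KG.
Qed.
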